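(* Let $(R,\mathfrak{m})$ be a local Noetherian ring of Krull dimension $d\geq 2$ whose residue field is finite. Then for each positive integer $n$ there is an ideal of $R$ that is minimally generated by $n$ elements and does not have a proper reduction. If moreover $n\geq d$, this ideal can be chosen to be $\mathfrak{m}$-primary.
   Context: A reduction of an ideal $I$ is an ideal $J\subseteq I$ such that $I^{m+1}=JI^m$ for some $m>0$; it is proper if $J\neq I$. *)

(* Defs.v *)
From HB Require Import structures.
From mathcomp Require Import all_boot all_order all_algebra.
Set Implicit Arguments. Unset Strict Implicit. Unset Printing Implicit Defensive.
Import GRing.Theory.
Local Open Scope ring_scope.

Section Ideals.
Variable R : comNzRingType.

Definition rset := R -> Prop.
Definition rset_eq (I J : rset) := forall x, I x <-> J x.
Definition rset_sub (I J : rset) := forall x, I x -> J x.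

Definition ideal (I : rset) : Prop :=
  I 0 /\ (forall x y, I x -> I y -> I (x + y)) /\ (forall a x, I x -> I (a * x)).

Definition proper_ideal (I : rset) := ideal I /\ ~ I 1.

Definition span (n : nat) (g : 'I_n -> R) : rset :=
  fun x => exists c : 'I_n -> R, x = \sum_(i < n) c i * g i.

Definition fin_gen (I : rset) := exists n (g : 'I_n -> R), rset_eq I (span g).

Definition min_gens (I : rset) (n : nat) :=
  (exists g : 'I_n -> R, rset_eq I (span g)) /\
  (forall k (g : 'I_k -> R), rset_eq I (span g) -> (n <= k)%N).

Definition iprod (I J : rset) : rset :=
  fun x => exists n (a b : 'I_n -> R),
    (forall i, I (a i)) /\ (forall i, J (b i)) /\ x = \sum_(i < n) a i * b i.

Fixpoint ipow (I : rset) (k : nat) : rset :=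
  match k with
  | O => fun _ => True
  | S k' => iprod I (ipow I k')
  end.

Definition reduction (J I : rset) :=
  ideal J /\ rset_sub J I /\
  exists m, (0 < m)%N /\ rset_eq (ipow I m.+1) (iprod J (ipow I m)).

Definition proper_reduction (J I : rset) := reduction J I /\ ~ rset_eq J I.

Definition no_proper_reduction (I : rset) := forall J, ~ proper_reduction J I.

Definition prime_ideal (P : rset) :=
  proper_ideal P /\ forall a b, P (a * b) -> P a \/ P b.

Definition maximal_ideal (M : rset) :=
  proper_ideal M /\ forall J, proper_ideal J -> rset_sub M J -> rset_eq J M.

Definition local_ring (m : rset) :=
  maximal_ideal m /\ forall M, maximal_ideal M -> rset_eq M m.

Definition noetherian := forall I, ideal I -> fin_gen I.

Definition prime_chain (P : nat -> rset) (k : nat) :=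
  (forall i, (i <= k)%N -> prime_ideal (P i)) /\
  (forall i, (i < k)%N -> rset_sub (P i) (P i.+1) /\ ~ rset_eq (P i) (P i.+1)).

Definition krull_dim (d : nat) :=
  (exists P, prime_chain P d) /\ (forall P k, prime_chain P k -> (k <= d)%N).

Definition finite_residue_field (m : rset) :=
  exists s : seq R, forall x, exists2 y, y \in s & m (x - y).

Definition radical (I : rset) : rset := fun x => exists k, I (x ^+ k).

Definition primary_ideal (I : rset) :=
  proper_ideal I /\ forall a b, I (a * b) -> I a \/ radical I b.

Definition m_primary (m I : rset) := primary_ideal I /\ rset_eq (radical I) m.

End Ideals.

(* Main.v *)
(* Call a prime of coheight one if it is maximal among the primes other than m. By prime avoidance
   and Krull's principal ideal theorem there are infinitely many of them, since d >= 2.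
   Attach to every point t of P^(n-1)(k) a coheight one prime P_t, all distinct, and an
   element u_t of m lying in every P_t' with t' <> t but not in P_t. If f_1, ..., f_n
   satisfy f_i = t_i u_t mod P_t for all t, then I = (f_1, ..., f_n) has no proper
   reduction: a proper subideal J lies in the hyperplane of I / mI given by some t, and
   modulo P_t one gets I = (u_t) and J inside m u_t, so that I^(k+1) = J I^k would put u_t
   in P_t. The same argument shows that n generators are needed. The f_i may be changed by
   any element of the intersection of the P_t; by avoidance of cosets they can be chosen
   so that, outside m and the P_t, each f_i lowers the dimension, and then I is m-primary
   as soon as n >= d. *)
From Stdlib Require Import Classical ClassicalEpsilon.
From Stdlib Require List.
From mathcomp Require Import all_boot all_order all_algebra.
From mathcomp Require Import ring.
Require Import Defs.

Set Implicit Arguments.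
Unset Strict Implicit.
Unset Printing Implicit Defensive.

Import GRing.Theory.

(** * Ideals, spans, products and powers *)

Section IdealTheory.
Local Open Scope ring_scope.
Variable R : comNzRingType.
Implicit Types (A B I J P Q : rset R) (L : list (rset R)).

Lemma ideal0 I : ideal I -> I 0. Proof. by case. Qed.

Lemma idealD I x y : ideal I -> I x -> I y -> I (x + y).
Proof. by move=> [_ [h _]]; apply: h. Qed.

Lemma idealMl I a x : ideal I -> I x -> I (a * x).
Proof. by move=> [_ [_ h]]; apply: h. Qed.

Lemma idealMr I a x : ideal I -> I x -> I (x * a).
Proof. by move=> hI hx; rewrite mulrC; apply: idealMl. Qed.

Lemma idealN I x : ideal I -> I x -> I (- x).
Proof. by move=> hI hx; rewrite -mulN1r; apply: idealMl. Qed.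

Lemma idealB I x y : ideal I -> I x -> I y -> I (x - y).
Proof. by move=> hI hx hy; apply: idealD => //; apply: idealN. Qed.

Lemma ideal_subr I x y : ideal I -> I (x - y) -> I y -> I x.
Proof. by move=> hI h hy; rewrite -(subrK y x); apply: idealD. Qed.

Lemma ideal_subl I x y : ideal I -> I (x - y) -> I x -> I y.
Proof. by move=> hI h hx; rewrite -(subKr x y); apply: idealB. Qed.

Lemma ideal_sum I n (F : nat -> R) :
  ideal I -> (forall i, (i < n)%N -> I (F i)) -> I (\sum_(i < n) F i).
Proof.
move=> hI hF; apply: (big_ind I) => [|x y|i _]; first exact: ideal0.
- exact: idealD.
- exact: hF.
Qed.

Lemma ideal_span n (g : 'I_n -> R) : ideal (span g).
Proof.
split; [|split].
- by exists (fun _ => 0); rewrite big1 // => i _; rewrite mul0r.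
- move=> x y [c ->] [e ->]; exists (fun i => c i + e i).
  by rewrite -big_split; apply: eq_bigr => i _; rewrite mulrDl.
- move=> a x [c ->]; exists (fun i => a * c i).
  by rewrite mulr_sumr; apply: eq_bigr => i _; rewrite mulrA.
Qed.

Lemma span_gen n (g : 'I_n -> R) i : span g (g i).
Proof.
exists (fun j => (j == i)%:R); rewrite (bigD1 i) //= eqxx mul1r big1 ?addr0 //.
by move=> j /negPf->; rewrite mul0r.
Qed.

(** Finite families become functions on [nat], so that inductions on the number of generators
    involve no change of index type; [x0] is the value beyond [n]. *)
Lemma ord_ext (X : Type) (x0 : X) n (c : 'I_n -> X) :
  exists c' : nat -> X, forall i : 'I_n, c' i = c i.
Proof.
exists (fun k => if insub k is Some i then c i else x0) => i.
by rewrite valK.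
Qed.

Lemma span_natP n (f : nat -> R) x :
  span (fun i : 'I_n => f i) x <-> exists c : nat -> R, x = \sum_(i < n) c i * f i.
Proof.
split=> [[c ->]|[c ->]]; last by exists (fun i => c i).
have [c' hc'] := ord_ext 0 c; exists c'.
by apply: eq_bigr => i _; rewrite hc'.
Qed.

Lemma fin_gen_nat I : fin_gen I -> exists n (f : nat -> R),
  (forall i, (i < n)%N -> I (f i)) /\
  (forall x, I x -> exists c : nat -> R, x = \sum_(i < n) c i * f i).
Proof.
case=> n [g hg]; have [f hf] := ord_ext 0 g; exists n, f; split.
- by move=> i lt_in; have := hf (Ordinal lt_in); move=> /= ->; apply/hg/span_gen.
- move=> x /hg [c ->]; apply/span_natP.
  by exists c; apply: eq_bigr => i _; rewrite hf.
Qed.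

Definition adjoin I a : rset R := fun x => exists y r, I y /\ x = y + r * a.

Lemma ideal_adjoin I a : ideal I -> ideal (adjoin I a).
Proof.
move=> hI; split; [|split].
- by exists 0, 0; split; [apply: ideal0 | ring].
- move=> x y [x' [r [hx ->]]] [y' [s [hy ->]]].
  by exists (x' + y'), (r + s); split; [apply: idealD | ring].
- move=> b x [x' [r [hx ->]]].
  by exists (b * x'), (b * r); split; [apply: idealMl | ring].
Qed.

Lemma adjoin_sub I a : rset_sub I (adjoin I a).
Proof. by move=> x hx; exists x, 0; split=> //; ring. Qed.

Lemma adjoin_gen I a : ideal I -> adjoin I a a.
Proof. by move=> hI; exists 0, 1; split; [apply: ideal0 | ring]. Qed.

Lemma adjoin_min I J a : ideal J -> rset_sub I J -> J a -> rset_sub (adjoin I a) J.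
Proof. by move=> hJ hIJ ha x [y [r [hy ->]]]; apply: idealD; [|apply: hIJ|apply: idealMl]. Qed.

Lemma ideal_iprod I J : ideal I -> ideal (iprod I J).
Proof.
move=> hI; split; [|split].
- exists 0%N, (fun _ => 0), (fun _ => 0).
  by split; [case|split; [case|rewrite big_ord0]].
- move=> x y [n1 [a1 [b1 [ha1 [hb1 ->]]]]] [n2 [a2 [b2 [ha2 [hb2 ->]]]]].
  exists (n1 + n2)%N,
    (fun i => match split i with inl j => a1 j | inr j => a2 j end),
    (fun i => match split i with inl j => b1 j | inr j => b2 j end).
  split; [|split]; try by move=> i; case: (split i).
  rewrite big_split_ord /=; congr (_ + _); apply: eq_bigr => i _.
  + by have := @unsplitK n1 n2 (inl i); move=> /= ->.
  + by have := @unsplitK n1 n2 (inr i); move=> /= ->.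
- move=> r x [n [a [b [ha [hb ->]]]]].
  exists n, (fun i => r * a i), b; split; [|split] => //.
  + by move=> i; apply: idealMl.
  + by rewrite mulr_sumr; apply: eq_bigr => i _; rewrite mulrA.
Qed.

Lemma iprod_min I J B : ideal B -> (forall a b, I a -> J b -> B (a * b)) ->
  rset_sub (iprod I J) B.
Proof.
move=> hB h x [n [a [b [ha [hb ->]]]]].
by apply: (big_ind B) => [|y z|i _]; [apply: ideal0 | apply: idealD | apply: h].
Qed.

Lemma iprodM I J a b : I a -> J b -> iprod I J (a * b).
Proof.
move=> ha hb; exists 1%N, (fun _ => a), (fun _ => b).
by split; [|split] => //; rewrite big_ord1.
Qed.

Lemma ideal_ipow I k : ideal I -> ideal (ipow I k).
Proof. by case: k => [|k] hI; [split|apply: ideal_iprod]. Qed.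

Lemma ipowX I k x : I x -> ipow I k (x ^+ k).
Proof. by move=> hx; elim: k => [|k IH] //=; rewrite exprS; apply: iprodM. Qed.

Lemma ipow_decr I k : ideal I -> rset_sub (ipow I k.+1) (ipow I k).
Proof.
move=> hI; apply: iprod_min => [|a b _ hb]; first exact: ideal_ipow.
by apply: idealMl => //; apply: ideal_ipow.
Qed.

(** * Prime ideals, prime avoidance and Nakayama's lemma *)

Lemma prime_idealW P : prime_ideal P -> ideal P. Proof. by case=> [[]]. Qed.

Lemma prime_neq1 P : prime_ideal P -> ~ P 1. Proof. by case=> [[]]. Qed.

Lemma primeM P a b : prime_ideal P -> P (a * b) -> P a \/ P b.
Proof. by case=> _; apply. Qed.

Lemma primeNM P a b : prime_ideal P -> ~ P a -> ~ P b -> ~ P (a * b).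
Proof. by move=> hP ha hb /(primeM hP) []. Qed.

Lemma primeX P a k : prime_ideal P -> P (a ^+ k) -> P a.
Proof.
move=> hP; elim: k => [|k IH]; first by rewrite expr0 => /(prime_neq1 hP).
by rewrite exprS => /(primeM hP) [].
Qed.

Lemma rset_eqW I J : rset_sub I J -> rset_sub J I -> rset_eq I J.
Proof. by move=> h1 h2 x; split; [apply: h1|apply: h2]. Qed.

Lemma not_sub I J : ~ rset_sub I J -> exists x, I x /\ ~ J x.
Proof.
by move=> h; apply: NNPP => h2; apply: h => x hx; apply: NNPP => hJ; apply: h2; exists x.
Qed.

(** Multiply elements outside [P], one from each ideal; primality keeps the product outside [P]. *)
Lemma prime_avoid_inter P L :
  prime_ideal P -> (forall J, List.In J L -> ideal J /\ ~ rset_sub J P) ->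
  exists u, ~ P u /\ forall J, List.In J L -> J u.
Proof.
move=> hP; elim: L => [|J L IH] h; first by exists 1; split=> //; apply: prime_neq1.
have [u [hu hL]] := IH (fun K hK => h K (or_intror hK)).
have [idJ /not_sub [e [he hPe]]] := h J (or_introl erefl).
exists (u * e); split; first exact: primeNM.
move=> K [<-|hK]; first exact: idealMl.
by apply: idealMr; [case: (h K (or_intror hK))|apply: hL].
Qed.

Lemma list_filter T (phi : T -> Prop) (L : list T) :
  exists L' : list T, forall x, List.In x L' <-> List.In x L /\ phi x.
Proof.
elim: L => [|y L [L' IH]]; first by exists nil => x; split=> [[]|[[]]].
have [hy|hy] := classic (phi y).
- exists (y :: L') => x /=; rewrite IH; split=> [[<-|[]]|[[<-|]]]; tauto.
- exists L' => x /=; rewrite IH; split=> [|[[eyx|]]]; try tauto.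
  by rewrite -eyx.
Qed.

(* For a prime [Q] not inside another member of the list, moving inside [A ∩ Q]
   preserves the avoidance of [Q] once it is achieved by [g] or [g + e]. *)
Lemma coset_prime_avoidance A g L :
  ideal A -> (forall Q, List.In Q L -> prime_ideal Q) ->
  (forall Q, List.In Q L -> rset_sub A Q -> ~ Q g) ->
  exists a, A a /\ forall Q, List.In Q L -> ~ Q (g + a).
Proof.
elim: L A g => [|Q L IH] A g idA hL hA.
  by exists 0; split=> //; apply: ideal0.
have hQ := hL Q (or_introl erefl); have idQ := prime_idealW hQ.
have hL' Q' : List.In Q' L -> prime_ideal Q' by move=> h; apply: hL; right.
have hA' Q' : List.In Q' L -> rset_sub A Q' -> ~ Q' g by move=> h; apply: hA; right.
have [[Q' [inQ' sQQ']]|nQ] := classic (exists Q', List.In Q' L /\ rset_sub Q Q').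
  have [a [ha ha']] := IH A g idA hL' hA'.
  exists a; split=> // K [<-|]; last exact: ha'.
  by move=> /sQQ'; apply: ha'.
have [sAQ|/not_sub [e [Ae Qe]]] := classic (rset_sub A Q).
  have [a [ha ha']] := IH A g idA hL' hA'.
  exists a; split=> // K [<-|]; last exact: ha'.
  move=> hga; apply: (hA Q (or_introl erefl) sAQ).
  by rewrite -(addrK a g); apply: idealB => //; apply: sAQ.
have [g' [Qg' [e' [Ae' eg']]]] : exists g', ~ Q g' /\ exists e', A e' /\ g' = g + e'.
  have [Qg|Qg] := classic (Q g).
  - exists (g + e); split; last by exists e.
    by move=> h; apply: Qe; rewrite -(addKr g e) addrC; apply: idealB.
  - exists g; split=> //; exists 0; split; [exact: ideal0|by rewrite addr0].
have idAQ : ideal (fun x => A x /\ Q x).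
  split; [|split].
  - by split; apply: ideal0.
  - by move=> x y [h1 h2] [h3 h4]; split; apply: idealD.
  - by move=> a x [h1 h2]; split; apply: idealMl.
have [|a [[Aa Qa] ha]] := IH _ g' idAQ hL'.
  move=> Q' inQ' sub Qg''; have hQ' := hL' _ inQ'.
  have [f [Qf Q'f]] : exists f, Q f /\ ~ Q' f.
    by apply: not_sub => h; apply: nQ; exists Q'.
  have sAQ' : rset_sub A Q'.
    move=> x Ax; have /(primeM hQ') [] // : Q' (x * f).
    by apply: sub; split; [apply: idealMr|apply: idealMl].
  apply: (hA' Q' inQ' sAQ'); rewrite -(addrK e' g) -eg'.
  by apply: idealB; [apply: prime_idealW| |apply: sAQ'].
exists (e' + a); split; first exact: idealD.
move=> K; rewrite addrA -eg' => -[<-|]; last exact: ha.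
move=> h; apply: Qg'; rewrite -(addrK a g').
exact: idealB.
Qed.

(* Localised at [Q], this is Nakayama's lemma for the module generated by the [g i]
   modulo [A]; it is proved by eliminating the last generator. *)
Lemma nakayama_prime Q A n (g : nat -> R) :
  prime_ideal Q -> ideal A ->
  (forall i, (i < n)%N -> exists (t : R) (c : nat -> R), ~ Q t /\ (forall j, Q (c j)) /\
      A (t * g i - \sum_(j < n) c j * g j)) ->
  forall i, (i < n)%N -> exists t, ~ Q t /\ A (t * g i).
Proof.
move=> hQ idA; have idQ := prime_idealW hQ.
elim: n => [//|n IH] h.
have [t [c [ht [hc hA]]]] := h n (ltnSn n).
(* Absorbing the [g n] term of its own relation leaves this coefficient, still outside [Q] because
   [c n] lies in [Q]. *)
pose s := t - c n.
have hs : ~ Q s by move=> hs; apply: ht; apply: (ideal_subr idQ hs).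
have hAn : A (s * g n - \sum_(j < n) c j * g j).
  by move: hA; rewrite big_ord_recr /=; congr A; rewrite /s; ring.
have {}IH : forall i, (i < n)%N -> exists t, ~ Q t /\ A (t * g i).
  apply: IH => i lt_in; have [t' [c' [ht' [hc' hA']]]] := h i (ltnW lt_in : (i < n.+1)%N).
  exists (s * t'), (fun j => s * c' j + c' n * c j); split; first exact: primeNM.
  split=> [j|]; first by apply: idealD => //; apply: idealMl.
  move: hA'; rewrite big_ord_recr /= => hA'.
  have := idealD idA (idealMl s idA hA') (idealMl (c' n) idA hAn); congr A.
  have -> : \sum_(j < n) (s * c' j + c' n * c j) * g j =
     s * \sum_(j < n) c' j * g j + c' n * \sum_(j < n) c j * g j.
    by rewrite !mulr_sumr -big_split; apply: eq_bigr => j _ /=; ring.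
  by ring.
have [t1 [ht1 hA1]] : exists t1, ~ Q t1 /\ forall j, (j < n)%N -> A (t1 * g j).
  move: IH; elim: (n) => [|k IHk] IH.
    by exists 1; split=> //; apply: prime_neq1.
  have [|t1 [ht1 hA1]] := IHk; first by move=> i lt_ik; apply: IH; apply: ltnW.
  have [t2 [ht2 hA2]] := IH k (ltnSn k).
  exists (t1 * t2); split; first exact: primeNM.
  move=> j; rewrite ltnS leq_eqVlt => /orP [/eqP->|lt_jk].
  - by rewrite -mulrA; apply: idealMl.
  - by rewrite mulrAC; apply: idealMr => //; apply: hA1.
move=> i; rewrite ltnS leq_eqVlt => /orP [/eqP->|]; last exact: IH.
exists (t1 * s); split; first exact: primeNM.
have : A (t1 * \sum_(j < n) c j * g j).
  rewrite mulr_sumr; apply: (@ideal_sum _ _ (fun j => t1 * (c j * g j))) => // j lt_jn.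
  by rewrite mulrCA; apply: idealMl => //; apply: hA1.
by apply: ideal_subr => //; rewrite -mulrA -mulrBr; apply: idealMl.
Qed.

End IdealTheory.

(** * Noetherian induction and the primes over an ideal *)

Section Noetherian.
Local Open Scope ring_scope.
Variable R : comNzRingType.
Hypothesis noethR : noetherian R.
Implicit Types (A B I J P Q : rset R) (L : list (rset R)).

(** The union of the chain is finitely generated, and its generators already lie in one member. *)
Lemma noetherian_acc (I : nat -> rset R) :
  (forall k, ideal (I k)) -> (forall k, rset_sub (I k) (I k.+1)) ->
  exists k, rset_sub (I k.+1) (I k).
Proof.
move=> idI incI.
have mono j k : (j <= k)%N -> rset_sub (I j) (I k).
  elim: k => [|k IH]; first by rewrite leqn0 => /eqP->.
  rewrite leq_eqVlt => /orP [/eqP->//|]; rewrite ltnS => /IH h x /h.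
  exact: incI.
have idU : ideal (fun x => exists k, I k x).
  split; [|split].
  - by exists 0%N; apply: ideal0.
  - move=> x y [j hx] [k hy]; exists (maxn j k); apply: idealD => //.
    + by apply: (mono j); rewrite ?leq_maxl.
    + by apply: (mono k); rewrite ?leq_maxr.
  - by move=> a x [j hx]; exists j; apply: idealMl.
have [n [f [hf gen]]] := fin_gen_nat (noethR idU).
have [k hk] : exists k, forall i, (i < n)%N -> I k (f i).
  elim: n hf {gen} => [|n IH] hf; first by exists 0%N.
  have [|k hk] := IH; first by move=> i lt_in; apply: hf; apply: ltnW.
  have [j hj] := hf n (ltnSn n).
  exists (maxn j k) => i; rewrite ltnS leq_eqVlt => /orP [/eqP->|/hk h].
  - by apply: (mono j); rewrite ?leq_maxl.
  - by apply: (mono k); rewrite ?leq_maxr.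
exists k => x hx; have [|c ->] := gen x; first by exists k.+1.
by apply: (@ideal_sum _ _ _ (fun i => c i * f i)) => // i lt_in; apply: idealMl => //; apply: hk.
Qed.

(** Otherwise every counterexample lies strictly inside another, and dependent choice gives a chain
    that never stabilises. *)
Lemma noetherian_ind (Phi : rset R -> Prop) :
  (forall I, ideal I ->
     (forall J, ideal J -> rset_sub I J -> ~ rset_sub J I -> Phi J) -> Phi I) ->
  forall I, ideal I -> Phi I.
Proof.
move=> step I0 idI0; apply: NNPP => bad0.
pose T := {I : rset R | ideal I /\ ~ Phi I}.
have next (I : T) : {J : T | rset_sub (sval I) (sval J) /\ ~ rset_sub (sval J) (sval I)}.
  apply: constructive_indefinite_description.
  case: I => I [idI bad] /=; apply: NNPP => h; apply: bad; apply: step => // J idJ sIJ nJI.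
  by apply: NNPP => badJ; apply: h; exists (exist _ J (conj idJ badJ)).
pose s := fix s k : T :=
  if k is k'.+1 then sval (next (s k')) else exist _ I0 (conj idI0 bad0).
have [k|k|k] := @noetherian_acc (fun k => sval (s k)).
- by case: (svalP (s k)).
- by case: (svalP (next (s k))).
- by case: (svalP (next (s k))).
Qed.

(** A proper ideal that is not prime contains some ab with a and b outside it, and I + (a), I + (b)
    are strictly larger. *)
Lemma prime_adjoin_ind (Phi : rset R -> Prop) :
  (forall I, ideal I -> I 1 -> Phi I) ->
  (forall P, prime_ideal P -> Phi P) ->
  (forall I a b, ideal I -> I (a * b) ->
     Phi (adjoin I a) -> Phi (adjoin I b) -> Phi I) ->
  forall I, ideal I -> Phi I.
Proof.
move=> h1 hP hadj; apply: noetherian_ind => I idI IH.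
have [I1|I1] := classic (I 1); first exact: h1.
have [pI|npI] := classic (prime_ideal I); first exact: hP.
have [a [b [Iab [Ia Ib]]]] : exists a b, I (a * b) /\ ~ I a /\ ~ I b.
  apply: NNPP => h; apply: npI; split=> // a b Iab; apply: NNPP => nab.
  by apply: h; exists a, b; tauto.
have PhiA c : ~ I c -> Phi (adjoin I c).
  move=> Ic; apply: IH; first exact: ideal_adjoin.
  - exact: adjoin_sub.
  - by move=> h; apply: Ic; apply: h; apply: adjoin_gen.
by apply: (hadj _ a b) => //; apply: PhiA.
Qed.

Lemma finite_primes_over I : ideal I -> exists L,
  (forall Q, List.In Q L -> prime_ideal Q /\ rset_sub I Q) /\
  (forall Q, prime_ideal Q -> rset_sub I Q -> exists Q', List.In Q' L /\ rset_sub Q' Q).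
Proof.
elim/prime_adjoin_ind: I / => [I _ I1|P hP|I a b idI Iab [L1 [in1 ov1]] [L2 [in2 ov2]]].
- by exists nil; split=> // Q hQ sIQ; case: (prime_neq1 hQ (sIQ _ I1)).
- exists (P :: nil); split=> [Q [<-|[]]|Q _ sPQ]; first by split=> // x.
  by exists P; split=> //; left.
- exists (L1 ++ L2)%list; split=> [Q inQ|Q hQ sIQ].
  + have [/in1|/in2] := List.in_app_or _ _ _ inQ; move=> [hQ h];
      by split=> // x Ix; apply: h; apply: adjoin_sub.
  + have idQ := prime_idealW hQ.
    have [Qa|Qb] := primeM hQ (sIQ _ Iab).
    * have [|Q' [h1 h2]] := ov1 Q hQ; first exact: adjoin_min.
      by exists Q'; split=> //; apply/List.in_or_app; left.
    * have [|Q' [h1 h2]] := ov2 Q hQ; first exact: adjoin_min.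
      by exists Q'; split=> //; apply/List.in_or_app; right.
Qed.

(** If x^k lies in I + (a) and x^l in I + (b), then x^(k+l) lies in I + (ab) = I. *)
Lemma radical_of_primes I x : ideal I ->
  (forall Q, prime_ideal Q -> rset_sub I Q -> Q x) -> radical I x.
Proof.
elim/prime_adjoin_ind: I / => [I _ I1|P hP|I a b idI Iab IHa IHb] h.
- by exists 0%N.
- by exists 1%N; rewrite expr1; apply: h.
- have [|k hk] := IHa.
    by move=> Q hQ s; apply: h => // y Iy; apply: s; apply: adjoin_sub.
  have [|l [y [r [Iy hl]]]] := IHb.
    by move=> Q hQ s; apply: h => // y Iy; apply: s; apply: adjoin_sub.
  case: hk => z [s [Iz hk]]; exists (k + l)%N; rewrite exprD hk hl.
  have -> : (z + s * a) * (y + r * b) = z * (y + r * b) + s * a * y + s * r * (a * b) by ring.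
  apply: idealD => //; last exact: idealMl.
  by apply: idealD => //; [apply: idealMr|apply: idealMl].
Qed.

(** * The maximal ideal and primes of coheight one *)

Section Local.
Variable m : rset R.
Hypothesis locR : local_ring m.

Lemma ideal_m : ideal m. Proof. by case: locR => [[[]]]. Qed.

Lemma m_neq1 : ~ m 1. Proof. by case: locR => [[[]]]. Qed.

(** Noetherian induction takes the place of Zorn's lemma. *)
Lemma proper_sub_m I : ideal I -> ~ I 1 -> rset_sub I m.
Proof.
elim/noetherian_ind: I / => I idI IH I1.
have [mI|nmI] := classic (maximal_ideal I).
  by case: locR => _ /(_ _ mI) h x /h.
have [J [[idJ J1] [sIJ nJI]]] : exists J, proper_ideal J /\ rset_sub I J /\ ~ rset_sub J I.
  apply: NNPP => h; apply: nmI; split=> // J pJ sIJ; apply: rset_eqW => //.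
  by apply: NNPP => nJI; apply: h; exists J.
by move=> x /sIJ; apply: IH.
Qed.

Lemma unit_of_not_m x : ~ m x -> exists y, y * x = 1.
Proof.
move=> mx; apply: NNPP => nu; apply: mx.
have idx : ideal (fun z => exists y, z = y * x).
  split; [|split].
  - by exists 0; rewrite mul0r.
  - by move=> _ _ [y ->] [z ->]; exists (y + z); rewrite mulrDl.
  - by move=> a _ [y ->]; exists (a * y); rewrite mulrA.
apply: (proper_sub_m idx); last by exists 1; rewrite mul1r.
by case=> y e; apply: nu; exists y.
Qed.

Lemma prime_m : prime_ideal m.
Proof.
split=> [|a b mab]; first by split; [apply: ideal_m|apply: m_neq1].
apply: NNPP => h; have [|y hy] := @unit_of_not_m a; first by move=> ma; apply: h; left.
apply: h; right; rewrite -(mul1r b) -hy -mulrA.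
exact: idealMl ideal_m mab.
Qed.

Lemma prime_sub_m Q : prime_ideal Q -> rset_sub Q m.
Proof. by move=> hQ; apply: proper_sub_m; [apply: prime_idealW|apply: prime_neq1]. Qed.

Definition coheight_one P := prime_ideal P /\ ~ rset_sub m P /\
  forall Q, prime_ideal Q -> rset_sub P Q -> rset_sub Q P \/ rset_sub m Q.

Lemma sub_coheight_one Q : prime_ideal Q -> ~ rset_sub m Q ->
  exists P, coheight_one P /\ rset_sub Q P.
Proof.
move=> hQ; have idQ := prime_idealW hQ; move: Q idQ hQ.
apply: noetherian_ind => Q idQ IH hQ nQ.
have [[Q' [hQ' [sQQ' [nQ'Q nmQ']]]]|h] := classic (exists Q', prime_ideal Q' /\
    rset_sub Q Q' /\ ~ rset_sub Q' Q /\ ~ rset_sub m Q').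
  have [P [hP sQ'P]] := IH _ (prime_idealW hQ') sQQ' nQ'Q hQ' nmQ'.
  by exists P; split=> // x /sQQ' /sQ'P.
exists Q; split=> //; split=> //; split=> // Q' hQ' sQQ'.
by apply: NNPP => h'; apply: h; exists Q'; tauto.
Qed.

(** * Finite quotients and descending chains *)

Hypothesis finR : finite_residue_field m.

(** When ab lies in [B], the elements y + za, with y representing the classes modulo B + (a) and z
    those modulo B + (b), represent all classes modulo [B]. *)
Lemma finite_quotient B : ideal B ->
  (forall Q, prime_ideal Q -> rset_sub B Q -> rset_sub m Q) ->
  exists s : list R, forall x, exists y, List.In y s /\ B (x - y).
Proof.
elim/prime_adjoin_ind: B / => [B idB B1|P hP|B a b idB Bab IHa IHb] h.
- exists (0 :: nil) => x; exists 0; split; first by left.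
  by rewrite -(mulr1 (x - 0)); apply: idealMl.
- have smP := h P hP (fun _ h => h).
  case: finR => s hs; exists s => x; have [y ys my] := hs x.
  exists y; split; last exact: smP.
  elim: s ys {hs} => //= z s IH; rewrite inE => /orP [/eqP->|/IH]; tauto.
- have hadj c Q : prime_ideal Q -> rset_sub (adjoin B c) Q -> rset_sub m Q.
    by move=> hQ s; apply: h => // y By; apply: s; apply: adjoin_sub.
  have [s1 h1] := IHa (hadj a); have [s2 h2] := IHb (hadj b).
  exists (List.flat_map (fun y => List.map (fun z => y + z * a) s2) s1) => x.
  have [y [ys [u [r [Bu hr]]]]] := h1 x; have [z [zs [v [q [Bv hq]]]]] := h2 r.
  exists (y + z * a); split.
    by apply/List.in_flat_map; exists y; split=> //; apply/List.in_map_iff; exists z.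
  have -> : x - (y + z * a) = u + (v * a + q * (a * b)).
    rewrite opprD addrA hr -addrA; congr (_ + _).
    by rewrite -mulrBl hq; ring.
  by apply: idealD => //; apply: idealD => //; [apply: idealMr|apply: idealMl].
Qed.

(** Each listed element stays in all the [C n] or leaves at some stage; past the largest such stage
    nothing changes on the list. *)
Lemma list_stabilise (T : Type) (C : nat -> T -> Prop) (s : list T) :
  (forall n x, C n.+1 x -> C n x) ->
  exists n, forall x, List.In x s -> C n x -> C n.+1 x.
Proof.
move=> decC.
have mono j k x : (j <= k)%N -> C k x -> C j x.
  elim: k => [|k IH]; first by rewrite leqn0 => /eqP->.
  rewrite leq_eqVlt => /orP [/eqP->//|]; rewrite ltnS => /IH h /decC.
  exact: h.
suff [n hn] : exists n, forall x, List.In x s -> C n x -> forall k, C k x.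
  by exists n => x xs Cx; apply: hn Cx _.
elim: s => [|x s [n IH]]; first by exists 0%N.
have [hx|/not_all_ex_not [k hk]] := classic (forall k, C k x).
  by exists n => y [<-|/IH].
exists (maxn k n) => y [<-|ys] Cy.
- by case: hk; apply: mono Cy; rewrite leq_maxl.
- by apply: IH => //; apply: mono Cy; rewrite leq_maxr.
Qed.

(** * Symbolic powers and Krull's principal ideal theorem *)

Section SymbolicPowers.
Variables A Q : rset R.
Hypotheses (hA : prime_ideal A) (hQ : prime_ideal Q) (sAQ : rset_sub A Q).

(* The [k]-th symbolic power of [Q / A] in the domain [R / A]. *)
Definition sympow k : rset R := fun r =>
  exists t y z, ~ Q t /\ ipow Q k y /\ A z /\ t * r = y + z.

Let idA := prime_idealW hA.
Let idQ := prime_idealW hQ.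

Lemma ideal_sympow k : ideal (sympow k).
Proof.
have idk := ideal_ipow k idQ.
split; [|split].
- exists 1, 0, 0; split; first exact: prime_neq1.
  by split; [apply: ideal0|split; [apply: ideal0|ring]].
- move=> r r' [t [y [z [ht [hy [hz e]]]]]] [t' [y' [z' [ht' [hy' [hz' e']]]]]].
  exists (t * t'), (t' * y + t * y'), (t' * z + t * z').
  split; first exact: primeNM.
  split; first by apply: idealD => //; apply: idealMl.
  split; first by apply: idealD => //; apply: idealMl.
  have -> : t * t' * (r + r') = t' * (t * r) + t * (t' * r') by ring.
  by rewrite e e'; ring.
- move=> a r [t [y [z [ht [hy [hz e]]]]]].
  exists t, (a * y), (a * z); split=> //.
  split; first exact: idealMl.
  split; first exact: idealMl.
  by rewrite mulrCA e mulrDr.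
Qed.

Lemma sympow_decr k : rset_sub (sympow k.+1) (sympow k).
Proof.
move=> r [t [y [z [ht [hy h]]]]]; exists t, y, z; do 2!split=> //.
exact: ipow_decr.
Qed.

Lemma sympow_cancel k t r : ~ Q t -> sympow k (t * r) -> sympow k r.
Proof.
move=> ht [s [y [z [hs [hy [hz e]]]]]]; exists (s * t), y, z.
by split; [apply: primeNM|rewrite -mulrA].
Qed.

Lemma sub_sympow k : rset_sub A (sympow k).
Proof.
move=> z hz; exists 1, 0, z; split; first exact: prime_neq1.
split; first by apply: ideal0; apply: ideal_ipow.
by split=> //; rewrite mul1r add0r.
Qed.

Lemma ipow_sympow k : rset_sub (ipow Q k) (sympow k).
Proof.
move=> y hy; exists 1, y, 0; split; first exact: prime_neq1.
by split=> //; split; [apply: ideal0|ring].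
Qed.

(** Locally at [Q] and modulo [A], stability gives Q^k = Q Q^k, so Nakayama's lemma puts Q^k in the
    prime [A]. *)
Lemma sympow_stable k : rset_sub (sympow k) (sympow k.+1) -> rset_sub Q A.
Proof.
move=> stab.
have [n [g [hg gen]]] := fin_gen_nat (noethR (ideal_ipow k idQ)).
have gA i : (i < n)%N -> A (g i).
  move=> lt_in.
  have [i' lt_i'n|t [ht hAt]] := @nakayama_prime _ Q A n g hQ idA _ i lt_in.
    have [t [y [z [ht [hy [hz e]]]]]] := stab _ (ipow_sympow (hg _ lt_i'n)).
    pose B x := exists c : nat -> R, (forall j, Q (c j)) /\ x = \sum_(j < n) c j * g j.
    have idB : ideal B.
      split; [|split].
      - exists (fun=> 0); split=> [j|]; first exact: ideal0.
        by rewrite big1 // => j _; rewrite mul0r.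
      - move=> _ _ [c [hc ->]] [c' [hc' ->]]; exists (fun j => c j + c' j).
        split=> [j|]; first exact: idealD.
        by rewrite -big_split; apply: eq_bigr => j _; rewrite mulrDl.
      - move=> a _ [c [hc ->]]; exists (fun j => a * c j).
        split=> [j|]; first exact: idealMl.
        by rewrite mulr_sumr; apply: eq_bigr => j _; rewrite mulrA.
    have [|c [hc ey]] := @iprod_min _ Q (ipow Q k) B idB _ _ hy.
      move=> a b Qa /gen [c ->]; exists (fun j => a * c j).
      split=> [j|]; first exact: idealMr.
      by rewrite mulr_sumr; apply: eq_bigr => j _; rewrite mulrA.
    by exists t, c; do 2!split=> //; rewrite e ey addrC addKr.
  by have [/sAQ//|//] := primeM hA hAt.
move=> x Qx; apply: (@primeX _ _ _ k hA).
have [c ->] := gen _ (ipowX k Qx).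
by apply: (@ideal_sum _ _ _ (fun i => c i * g i)) => // i lt_in; apply: idealMl => //; apply: gA.
Qed.

End SymbolicPowers.

(* The instance of Krull's principal ideal theorem that is needed: [m] minimal over
   [(x)] forces height at most one. Finiteness of the residue field makes
   [R / (A + (x))] finite, so descending chains of ideals stabilise there. *)
Lemma krull_principal A Q x : prime_ideal A -> prime_ideal Q -> rset_sub A Q ->
  ~ rset_sub m Q -> m x ->
  (forall P, prime_ideal P -> P x -> rset_sub m P) -> rset_sub Q A.
Proof.
move=> hA hQ sAQ nmQ mx Vx.
have idA := prime_idealW hA.
have Qx : ~ Q x by move=> /(Vx _ hQ).
have [|s hs] := @finite_quotient (adjoin A x) (ideal_adjoin _ idA).
  by move=> P hP sP; apply: Vx => //; apply: sP; apply: adjoin_gen.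
pose S := sympow A Q; have idS k : ideal (S k) by apply: ideal_sympow.
have [|k hk] := @list_stabilise R (fun k => adjoin (S k) x) s.
  move=> k y [z [r [hz ->]]]; exists z, r; split=> //; exact: sympow_decr.
apply: (sympow_stable hA hQ sAQ (k := k)).
(* As S_k + (x) is stable at [k], r = r' + bx with bx in S_k; [x] is outside [Q] and cancels. Hence
   S_k = S_(k+1) + x S_k. *)
have decomp r : S k r -> exists r' b, S k.+1 r' /\ S k b /\ r = r' + b * x.
  move=> hr; have [l [ls hl]] := hs r.
  have sAS j : rset_sub (adjoin A x) (adjoin (S j) x).
    by move=> y [z [c [hz ->]]]; exists z, c; split=> //; apply: sub_sympow.
  have idSx j := ideal_adjoin x (idS j).
  have /(hk l ls) hl' : adjoin (S k) x l.
    by apply: (ideal_subl (idSx k) (sAS k _ hl)); apply: adjoin_sub.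
  have [r' [b [hr' e]]] := ideal_subr (idSx k.+1) (sAS k.+1 _ hl) hl'.
  exists r', b; split=> //; split=> //.
  apply: (@sympow_cancel A Q hQ k x) => //.
  have -> : x * b = r - r' by rewrite e; ring.
  by apply: idealB => //; apply: sympow_decr.
have [n [g [hg gen]]] := fin_gen_nat (noethR (idS k)).
move=> r /gen [c ->].
apply: (@ideal_sum _ _ _ (fun i => c i * g i)) => // i lt_in; apply: idealMl => //.
(* Nakayama's lemma at [m] removes x S_k, because [x] lies in [m]. *)
have [i' lt_i'n|t [ht]] := @nakayama_prime _ m (S k.+1) n g prime_m (idS k.+1) _ i lt_in.
  have [r' [b [hr' [hb e]]]] := decomp _ (hg _ lt_i'n).
  have [c' eb] := gen _ hb; exists 1, (fun j => c' j * x).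
  split; first exact: m_neq1.
  split=> [j|]; first exact: idealMl ideal_m mx.
  have -> : \sum_(j < n) c' j * x * g j = b * x.
    by rewrite eb mulr_suml; apply: eq_bigr => j _; ring.
  by rewrite mul1r e addrK.
by apply: sympow_cancel => // /(prime_sub_m hQ).
Qed.

(** * Arbitrarily many primes of coheight one *)

(** Otherwise each coheight one prime lies in a listed one. An [x] in [m] avoiding the list then
    lies in no prime but [m], and Krull's theorem rules out the strict chain from [A] through [Q] to
    [m]. *)
Lemma coheight_one_new A Q L :
  prime_ideal A -> prime_ideal Q -> rset_sub A Q -> ~ rset_sub Q A -> ~ rset_sub m Q ->
  (forall P, List.In P L -> coheight_one P) ->
  exists P, coheight_one P /\ forall P', List.In P' L -> ~ rset_sub P P'.
Proof.
move=> hA hQ sAQ nQA nmQ hL; apply: NNPP => noP.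
have all_in P : coheight_one P -> exists P', List.In P' L /\ rset_sub P P'.
  move=> hP; apply: NNPP => h; apply: noP; exists P; split=> // P' inP' sub.
  by apply: h; exists P'.
have [P /hL []//|P /hL [_ []]//|x [mx]] := @coset_prime_avoidance _ m 0 L ideal_m.
rewrite add0r => hx; apply: nQA; apply: (@krull_principal A Q x) => // P hP Px.
apply: NNPP => nmP.
have [P1 [/all_in [P2 [inP2 sP12]] sPP1]] := sub_coheight_one hP nmP.
by apply: (hx _ inP2); apply/sP12/sPP1.
Qed.

Lemma In_map_mem (I : eqType) (X : Type) (F : I -> X) (s : seq I) x :
  List.In x (map F s) <-> exists2 i, i \in s & x = F i.
Proof.
elim: s => [|j s IH] /=; first by split=> [[]|[]].
rewrite IH; split=> [[<-|[i is_ ->]]|[i]].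
- by exists j; rewrite ?mem_head.
- by exists i => //; rewrite inE is_ orbT.
- by rewrite inE => /orP [/eqP->|is_] ->; [left|right; exists i].
Qed.

Lemma many_coheight_one A Q N :
  prime_ideal A -> prime_ideal Q -> rset_sub A Q -> ~ rset_sub Q A -> ~ rset_sub m Q ->
  exists P : nat -> rset R, (forall i, (i < N)%N -> coheight_one (P i)) /\
    forall i j, (i < N)%N -> (j < N)%N -> i <> j -> ~ rset_sub (P i) (P j).
Proof.
move=> hA hQ sAQ nQA nmQ; elim: N => [|N [P [hP incP]]]; first by exists (fun=> A).
have inL P' : List.In P' (map P (iota 0 N)) <-> exists2 i, (i < N)%N & P' = P i.
  by rewrite In_map_mem; split=> -[i hi ->]; exists i => //; move: hi; rewrite mem_iota add0n.
have [P' /inL [i ltiN ->]|P' [hP' newP']] :=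
  @coheight_one_new A Q (map P (iota 0 N)) hA hQ sAQ nQA nmQ.
  exact: hP.
have newP i : (i < N)%N -> ~ rset_sub P' (P i) by move=> ltiN; apply: newP'; apply/inL; exists i.
exists (fun i => if i == N then P' else P i); split=> [i|i j]; rewrite ltnS leq_eqVlt.
  by case: eqP => //= _; apply: hP.
rewrite [(j < _)%N]ltnS [(j <= _)%N]leq_eqVlt.
case: eqP => [->|_] /=; case: eqP => [->|_] //= ltiN ltjN nij.
- exact: newP.
(* By maximality of [P i], this inclusion would put [P'] inside [P i]. *)
- move=> sub; have [_ [_ /(_ P')]] := hP _ ltiN.
  by have [pP' [nmP' _]] := hP'; move=> /(_ pP' sub) [] //; apply: newP.
- exact: incP.
Qed.

(** * Interpolation at the chosen primes and drop of dimension *)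

Section Construction.
Variables (T : finType) (P : T -> rset R).
Hypothesis coheightP : forall t, coheight_one (P t).
Hypothesis incompP : forall t t', t <> t' -> ~ rset_sub (P t) (P t').

Let primeP t : prime_ideal (P t). Proof. by case: (coheightP t). Qed.
Let idealP t : ideal (P t). Proof. exact: prime_idealW. Qed.

Lemma separating_elements : exists u : T -> R, forall t,
  m (u t) /\ ~ P t (u t) /\ forall t', t' <> t -> P t' (u t).
Proof.
suff h t : exists x, m x /\ ~ P t x /\ forall t', t' <> t -> P t' x.
  exists (fun t => sval (constructive_indefinite_description _ (h t))) => t.
  by case: constructive_indefinite_description.
have [J|x [nPx hx]] :=
  @prime_avoid_inter _ (P t) (m :: map P [seq t' <- enum T | t' != t]) (primeP t).
  move=> [<-|/In_map_mem [t']]; first by split; [apply: ideal_m|case: (coheightP t) => _ []].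
  rewrite mem_filter => /andP [/eqP ntt' _] ->.
  by split=> //; apply: incompP.
exists x; split; first by apply: hx; left.
split=> // t' /eqP ntt'; apply: hx; right; apply/In_map_mem; exists t' => //.
by rewrite mem_filter ntt' mem_enum.
Qed.

(** The intersection of the [P t] lies in no such prime, so an element can be moved out of it
    without changing its residues modulo the [P t]. *)
Definition unconstrained Q := ~ rset_sub m Q /\ forall t, ~ rset_sub (P t) Q.

Variable u : T -> R.
Hypothesis u_sep : forall t t', t' <> t -> P t' (u t).

Lemma interpolating_avoidance (c : T -> R) L :
  (forall Q, List.In Q L -> prime_ideal Q) ->
  exists g, (forall t, P t (g - c t * u t)) /\
    forall Q, List.In Q L -> unconstrained Q -> ~ Q g.
Proof.
move=> hL; have [L' hL'] := list_filter unconstrained L.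
have idA : ideal (fun x => forall t, P t x).
  split; [|split].
  - by move=> t; apply: ideal0.
  - by move=> x y hx hy t; apply: idealD.
  - by move=> a x hx t; apply: idealMl.
have [Q /hL' [/hL]//|Q /hL' [/hL hQ [nmQ nPQ]] sAQ _|a [ha hav]] :=
    @coset_prime_avoidance _ _ (\sum_t c t * u t) L' idA.
  have [J|x [nQx hx]] := @prime_avoid_inter _ Q (map P (enum T)) hQ.
    by move=> /In_map_mem [t _ ->].
  apply: nQx; apply: sAQ => t; apply: hx; apply/In_map_mem.
  by exists t; rewrite ?mem_enum.
exists (\sum_t c t * u t + a); split=> [t|Q inQ uQ]; last by apply: hav; apply/hL'.
rewrite (bigD1 t) //=; set S := (X in _ + X + a).
have -> : c t * u t + S + a - c t * u t = S + a by ring.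
apply: idealD => //; rewrite /S.
apply: (big_ind (P t)) => [|x y|t' /eqP ntt']; [exact: ideal0|exact: idealD|].
by apply: idealMl => //; apply: u_sep => e; apply: ntt'.
Qed.

Variable d : nat.
Hypothesis dimR : krull_dim R d.

(** Each new term avoids the unconstrained primes among finitely many that include all minimal
    primes over the earlier terms. Dropping the last term therefore allows one more prime at the
    bottom of the chain. *)
Lemma interpolating_seq (c : T -> nat -> R) n :
  exists f : nat -> R, (forall i t, (i < n)%N -> P t (f i - c t i * u t)) /\
    forall Qs k, prime_chain Qs k -> (forall i, (i < n)%N -> Qs 0%N (f i)) ->
      unconstrained (Qs 0%N) -> (k + n <= d)%N.
Proof.
elim: n => [|n [f [hf dimf]]].
  by exists (fun=> 0); split=> // Qs k hQs _ _; rewrite addn0; case: dimR => _; apply; exact: hQs.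
have [L [hL ovL]] := finite_primes_over (ideal_span (fun i : 'I_n => f i)).
have [Q /hL []//|g [hg gav]] := @interpolating_avoidance (c^~ n) L.
exists (fun i => if i == n then g else f i); split=> [i t|Qs k hQs hQ0 [nm nP]].
  by rewrite ltnS leq_eqVlt; case: eqP => [->|_] //=; apply: hf.
have prQ0 : prime_ideal (Qs 0%N) by case: hQs => h _; apply: h.
have fQ0 i : (i < n)%N -> Qs 0%N (f i).
  by move=> lt_in; have := hQ0 i (ltnW lt_in); rewrite (ltn_eqF lt_in).
have gQ0 : Qs 0%N g by have := hQ0 n (ltnSn n); rewrite eqxx.
have [|Q [inQ sQ]] := ovL _ prQ0.
  move=> x /span_natP [b ->].
  apply: (@ideal_sum _ _ _ (fun i => b i * f i)) => [|i lt_in]; first exact: prime_idealW.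
  by apply: idealMl; [apply: prime_idealW|apply: fQ0].
have [hQ sIQ] := hL _ inQ.
have uQ : unconstrained Q.
  by split=> [h|t h]; [apply: nm|apply: (nP t)] => x /h /sQ.
(* Prepend [Q] to the chain; strictness holds since [g] lies in [Qs 0] but not in [Q]. *)
rewrite addnS -addSn; apply: (dimf (fun i => if i is i'.+1 then Qs i' else Q)) => //=.
- case: hQs => h1 h2; split=> [[|i]|[|i]] //=; try exact: h1; try exact: h2.
  by move=> _; split=> // /(_ g) [_ /(_ gQ0)]; apply: gav.
- by move=> i lt_in; apply/sIQ/(span_gen (fun i : 'I_n => f i) (Ordinal lt_in)).
Qed.

End Construction.

(** * The primary criterion and the obstruction to reductions *)

Lemma m_primaryP I : ideal I -> rset_sub I m ->
  (forall Q, prime_ideal Q -> rset_sub I Q -> rset_sub m Q) -> m_primary m I.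
Proof.
move=> idI sIm VI.
have rad : rset_eq (radical I) m.
  move=> x; split=> [[k /sIm]|mx]; first exact: primeX prime_m.
  by apply: radical_of_primes => // Q hQ sIQ; apply: VI mx.
split=> //; split=> [|a b Iab]; first by split=> // /sIm; apply: m_neq1.
have [mb|mb] := classic (m b); first by right; apply/rad.
left; have [y hy] := unit_of_not_m mb.
by rewrite -(mulr1 a) -hy mulrCA; apply: idealMl.
Qed.

(* Modulo [P] one has [I = (u)] and [J] inside [m u], and [u] is not nilpotent. *)
Lemma hyperplane_not_reduction P n (f c : nat -> R) u i0 J k :
  prime_ideal P -> ~ P u -> (forall i, (i < n)%N -> P (f i - c i * u)) ->
  (i0 < n)%N -> ~ m (c i0) ->
  (forall x, J x -> exists b : nat -> R,
     x = \sum_(i < n) b i * f i /\ m (\sum_(i < n) b i * c i)) ->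
  ~ rset_sub (ipow (span (fun i : 'I_n => f i)) k.+1)
             (iprod J (ipow (span (fun i : 'I_n => f i)) k)).
Proof.
move=> hP Pu hf lt_i0 mc hJ; set I := span _; have idP := prime_idealW hP.
have comb (b : nat -> R) : P (\sum_(i < n) b i * f i - (\sum_(i < n) b i * c i) * u).
  rewrite mulr_suml -sumrB.
  apply: (@ideal_sum _ _ _ (fun i => b i * f i - b i * c i * u)) => // i lt_in.
  by rewrite -mulrA -mulrBr; apply: idealMl => //; apply: hf.
(* The preimage of A u^j under reduction modulo [P]. It contains I^j when [A] is the whole ring, and
   J I^k when [A] is [m] and j = k+1. *)
pose U (A : rset R) j : rset R := fun x => exists r, A r /\ P (x - r * u ^+ j).
have idU A j : ideal A -> ideal (U A j).
  move=> idA; split; [|split].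
  - by exists 0; split; [apply: ideal0|rewrite mul0r subr0; apply: ideal0].
  - move=> x y [r [Ar hr]] [s [As hs]]; exists (r + s); split; first exact: idealD.
    by have := idealD idP hr hs; congr P; ring.
  - move=> a x [r [Ar hr]]; exists (a * r); split; first exact: idealMl.
    by have := idealMl a idP hr; congr P; ring.
have UM A j x y r s : P (x - r * u) -> P (y - s * u ^+ j) -> A (r * s) -> U A j.+1 (x * y).
  move=> hr hs Ars; exists (r * s); split=> //.
  have := idealD idP (idealMr y idP hr) (idealMl (r * u) idP hs).
  by congr P; rewrite exprS; ring.
pose one : rset R := fun _ => True; have idone : ideal one by [].
have IU j : rset_sub (ipow I j) (U one j).
  elim: j => [|j IH]; first by move=> x _; exists x; split=> //; rewrite mulr1 subrr; apply: ideal0.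
  apply: iprod_min; first exact: idU.
  move=> a b /span_natP [e ->] /IH [s [_ hs]].
  exact: UM (comb e) hs _.
have fI : I (f i0) by apply: (span_gen (fun i : 'I_n => f i) (Ordinal lt_i0)).
move=> /(_ _ (ipowX k.+1 fI)) h.
have [|a b Ja /IU [s [_ hs]]|r [mr hr]] := @iprod_min _ J (ipow I k) (U m k.+1) _ _ _ h.
- by apply: idU; apply: ideal_m.
- have [e [-> me]] := hJ a Ja.
  by apply: UM (comb e) hs _; apply: idealMr ideal_m me.
have hpow j : P (f i0 ^+ j - c i0 ^+ j * u ^+ j).
  elim: j => [|j IH]; first by rewrite !expr0 mulr1 subrr; apply: ideal0.
  have := idealD idP (idealMr (f i0 ^+ j) idP (hf _ lt_i0)) (idealMl (c i0 * u) idP IH).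
  by congr P; rewrite !exprS; ring.
(* Two expressions of f_i0^(k+1) modulo [P], one of them with coefficient [r] in [m]; cancelling the
   power of [u] puts [c i0] in [m]. *)
have : P ((c i0 ^+ k.+1 - r) * u ^+ k.+1).
  by have := idealB idP hr (hpow k.+1); congr P; ring.
move=> /(primeM hP) [/(prime_sub_m hP) hm|/(primeX hP)//].
by apply: mc; apply: (@primeX _ _ _ k.+1 prime_m); apply: ideal_subr ideal_m hm mr.
Qed.

(** * Linear algebra over the residue field *)

(** Elimination with Nakayama's lemma built in: a relation modulo [J] with unit last coefficient
    expresses the last generator through the others; without one, the last coordinate of every
    relation lies in [m]. *)
Lemma proper_in_hyperplane J n (f : nat -> R) : ideal J ->
  (forall i, (i < n)%N -> J (f i)) \/
  exists a : nat -> R, (exists2 i, (i < n)%N & ~ m (a i)) /\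
    forall c : nat -> R, J (\sum_(i < n) c i * f i) -> m (\sum_(i < n) c i * a i).
Proof.
move=> idJ; elim: n => [|n IH]; first by left.
have [[c [hc mc]]|no_rel] :=
  classic (exists c : nat -> R, J (\sum_(i < n.+1) c i * f i) /\ ~ m (c n)).
- have [w hw] := unit_of_not_m mc; pose b i := - w * c i.
  have hb : J (f n - \sum_(i < n) b i * f i).
    have := idealMl w idJ hc; rewrite big_ord_recr /= mulrDr mulrA hw mul1r.
    by congr J; rewrite addrC -sumrN mulr_sumr; congr (_ + _); apply: eq_bigr => i _; rewrite /b; ring.
  case: IH => [fJ|[a [[i lt_in mai] ha]]].
    left=> i; rewrite ltnS leq_eqVlt => /orP [/eqP->|]; last exact: fJ.
    apply: (ideal_subr idJ hb).
    by apply: (@ideal_sum _ _ _ (fun i => b i * f i)) => // j lt_jn; apply: idealMl => //; apply: fJ.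
  (* The last coordinate is the value dictated by the relation for [f n]. *)
  right; exists (fun i => if i == n then \sum_(j < n) b j * a j else a i); split.
    by exists i; [apply: ltnW|rewrite (ltn_eqF lt_in)].
  have extend (e : nat -> R) (h : nat -> R) x : \sum_(i < n.+1) e i * (if i == n :> nat then x else h i)
      = \sum_(i < n) e i * h i + e n * x.
    rewrite big_ord_recr /= eqxx; congr (_ + _); apply: eq_bigr => j _.
    by rewrite (ltn_eqF (ltn_ord j)).
  have merge (e h : nat -> R) : \sum_(i < n) (e i + e n * b i) * h i =
      \sum_(i < n) e i * h i + e n * \sum_(i < n) b i * h i.
    by rewrite mulr_sumr -big_split; apply: eq_bigr => j _ /=; ring.
  move=> e; rewrite big_ord_recr /= extend -merge => he.
  apply: (ha (fun i => e i + e n * b i)).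
  by rewrite merge; have := idealB idJ he (idealMl (e n) idJ hb); congr J; ring.
- right; exists (fun i => (i == n)%:R); split.
    by exists n => //; rewrite eqxx; apply: m_neq1.
  move=> c hc; rewrite big_ord_recr /= eqxx mulr1 big1 ?add0r.
    by apply: NNPP => mc; apply: no_rel; exists c.
  by move=> j _; rewrite (ltn_eqF (ltn_ord j)) mulr0.
Qed.

(** Gaussian elimination modulo [m]: a unit in the last column is a pivot that removes one row and
    one unknown; without one, the last basis vector is a solution. *)
Lemma residue_kernel k n (M : nat -> nat -> R) : (k < n)%N ->
  exists a : nat -> R, (exists2 i, (i < n)%N & ~ m (a i)) /\
    forall j, (j < k)%N -> m (\sum_(i < n) M j i * a i).
Proof.
elim: n k M => [//|n IH] k M lt_kn.
have [col0|/not_all_ex_not [j0 hj0]] := classic (forall j, (j < k)%N -> m (M j n)).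
  exists (fun i => (i == n)%:R); split; first by exists n => //; rewrite eqxx; exact: m_neq1.
  move=> j lt_jk; rewrite big_ord_recr /= eqxx mulr1 big1 ?add0r; first exact: col0.
  by move=> i _; rewrite (ltn_eqF (ltn_ord i)) mulr0.
have [lt_j0k mj0] := imply_to_and _ _ hj0.
have [w hw] := unit_of_not_m mj0.
case: k lt_kn lt_j0k {hj0} => [//|k] lt_kn lt_j0k.
(* [bump j0] runs through the rows other than the pivot row [j0], which afterwards determines the
   last unknown. *)
have [a [[i lt_in mai] ha]] :=
  IH k (fun j i => M (bump j0 j) i - M (bump j0 j) n * w * M j0 i) lt_kn.
pose S := \sum_(i < n) M j0 i * a i.
exists (fun i => if i == n then - w * S else a i); split.
  by exists i; [apply: ltnW|rewrite (ltn_eqF lt_in)].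
move=> j lt_jk; rewrite big_ord_recr /= eqxx.
have -> : \sum_(i < n) M j i * (if i == n :> nat then - w * S else a i) = \sum_(i < n) M j i * a i.
  by apply: eq_bigr => l _; rewrite (ltn_eqF (ltn_ord l)).
have [->|/eqP njj0] := classic (j = j0).
  have -> : \sum_(i < n) M j0 i * a i + M j0 n * (- w * S) = S - (w * M j0 n) * S by rewrite /S; ring.
  by rewrite hw mul1r subrr; apply: ideal0 ideal_m.
have ebump : bump j0 (unbump j0 j) = j by rewrite unbumpKcond (negPf njj0).
have /ha : (unbump j0 j < k)%N.
  rewrite /unbump; case: (ltngtP j0 j) njj0 => [h _|h _|//]; rewrite /= ?subn1 ?subn0.
  - by rewrite -ltnS prednK // (leq_ltn_trans _ h).
  - exact: leq_trans h lt_j0k.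
rewrite ebump; congr m.
have -> : M j n * (- w * S) = \sum_(l < n) - (M j n * w * (M j0 l * a l)).
  by rewrite sumrN -mulr_sumr -/S; ring.
by rewrite -big_split; apply: eq_bigr => l _ /=; ring.
Qed.

(** Vectors of residue representatives stand in for projective points. Proportional or equal vectors
    at distinct indices do no harm, since primes are attached to indices. *)
Lemma residue_points n : (0 < n)%N -> exists (T : finType) (c : T -> nat -> R),
  (forall t, exists2 i, (i < n)%N & ~ m (c t i)) /\
  forall a : nat -> R, (exists2 i, (i < n)%N & ~ m (a i)) ->
    exists t, forall i, (i < n)%N -> m (a i - c t i).
Proof.
move=> n_gt0; case: finR => s hs.
pose T : finType := {ffun 'I_n -> 'I_(size s)}.
pose v (t : T) i := if insub i is Some j then s`_(t j) else 0.
have pc (t : T) : exists c : nat -> R, (exists2 i, (i < n)%N & ~ m (c i)) /\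
    ((exists2 i, (i < n)%N & ~ m (v t i)) -> c = v t).
  have [h|h] := classic (exists2 i, (i < n)%N & ~ m (v t i)); first by exists (v t).
  (* A vector that vanishes modulo [m] is replaced by the constant 1. *)
  by exists (fun=> 1); split=> //; exists 0%N => //; apply: m_neq1.
exists T, (fun t => sval (constructive_indefinite_description _ (pc t))); split.
  by move=> t; case: constructive_indefinite_description => c [].
move=> a [i lt_in mai].
have hs' x : exists y, (index y s < size s)%N /\ m (x - y).
  by have [y ys my] := hs x; exists y; rewrite index_mem.
pose y x := sval (constructive_indefinite_description _ (hs' x)).
have hy x : (index (y x) s < size s)%N /\ m (x - y x).
  by rewrite /y; case: constructive_indefinite_description.
exists [ffun j : 'I_n => Ordinal (proj1 (hy (a j)))].
set t := finfun _.
have vE j : (j < n)%N -> m (a j - v t j).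
  move=> lt_jn; rewrite /v insubT ffunE /= nth_index -?index_mem; by case: (hy (a j)).
case: constructive_indefinite_description => c [_ /= ->] //.
exists i => // mv; apply: mai; apply: ideal_subr ideal_m (vE _ lt_in) mv.
Qed.

Lemma m_comb_congr n (a b c : nat -> R) :
  (forall i, (i < n)%N -> m (a i - c i)) ->
  m (\sum_(i < n) b i * a i) -> m (\sum_(i < n) b i * c i).
Proof.
move=> hac; apply: (ideal_subl ideal_m); rewrite -sumrB.
apply: (@ideal_sum _ _ _ (fun i => b i * a i - b i * c i)); first exact: ideal_m.
by move=> i lt_in; rewrite -mulrBr; apply: idealMl ideal_m _; apply: hac.
Qed.

End Local.
End Noetherian.

(** * Assembly: number of generators, reductions and the primary case *)

Theorem theorem3p8 (R : comNzRingType) (m : R -> Prop) (d : nat) :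
  local_ring m -> noetherian R -> krull_dim R d -> (2 <= d)%N ->
  finite_residue_field m ->
  forall n : nat, (0 < n)%N ->
    exists I : R -> Prop,
      ideal I /\ min_gens I n /\ no_proper_reduction I /\
      ((d <= n)%N -> m_primary m I).
Proof.
move=> locR noethR dimR d_ge2 finR n n_gt0.
have [T [c [cm cov]]] := residue_points locR finR n_gt0.
have [P [coP incP]] : exists P : T -> rset R, (forall t, coheight_one m (P t)) /\
    forall t t', t <> t' -> ~ rset_sub (P t) (P t').
  case: (dimR) => [[Qs [prQ incQ]] _].
  (* [Qs 1] strictly contains [Qs 0] and differs from [m], as it is strictly inside [Qs 2]. *)
  have [s01 n01] := incQ 0%N (ltnW d_ge2); have [s12 n12] := incQ 1%N d_ge2.
  have prQ2 := prQ 2 d_ge2.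
  have [|||Q [hQ incQ']] := @many_coheight_one R noethR m locR finR (Qs 0%N) (Qs 1%N)
      #|T| (prQ 0%N isT) (prQ 1%N (ltnW d_ge2)).
  - exact: s01.
  - by move=> s10; apply: n01; apply: rset_eqW.
  - move=> sm1; apply: n12; apply: rset_eqW => // x /(prime_sub_m noethR locR prQ2).
    exact: sm1.
  exists (fun t => Q (enum_rank t)); split=> [t|t t' ntt']; first exact: hQ.
  by apply: incQ' => // /val_inj /enum_rank_inj.
have [u hu] := separating_elements locR coP incP.
have [|f [hf dimf]] := interpolating_seq noethR coP _ dimR c n (u := u).
  by move=> t t'; case: (hu t) => _ [_]; apply.
pose I := span (fun i : 'I_n => f i); have idI : ideal I := ideal_span _.
have prP t : prime_ideal (P t) by case: (coP t).
(* Every hyperplane is given modulo [m] by some [c t], and reduction modulo [P t] then excludes the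
   inclusion. *)
have no_red J k (a : nat -> R) : (exists2 i, (i < n)%N & ~ m (a i)) ->
    (forall x, J x -> exists b : nat -> R,
       x = (\sum_(i < n) b i * f i)%R /\ m (\sum_(i < n) b i * a i)%R) ->
    ~ rset_sub (ipow I k.+1) (iprod J (ipow I k)).
  move=> /cov [t ht] hJ; have [i lt_in mci] := cm t; have [_ [nPu _]] := hu t.
  apply: (hyperplane_not_reduction noethR locR (prP t) nPu _ lt_in mci).
    by move=> j lt_jn; apply: hf.
  move=> x /hJ [b [-> mb]]; exists b; split=> //.
  exact: (m_comb_congr locR ht mb).
exists I; split=> //; split; [|split].
- split=> [|k g eqIg]; first by exists (fun i : 'I_n => f i).
  rewrite leqNgt; apply/negP => lt_kn.
  have gI (j : 'I_k) : exists b : nat -> R, g j = (\sum_(i < n) b i * f i)%R.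
    by apply/span_natP/eqIg/span_gen.
  have [M hM] := ord_ext (fun=> 0%R)
    (fun j => sval (constructive_indefinite_description _ (gI j))).
  have gM (j : 'I_k) : g j = (\sum_(i < n) M j i * f i)%R.
    by rewrite hM; case: constructive_indefinite_description.
  have [a [nza ha]] := residue_kernel noethR locR M lt_kn.
  (* Fewer generators would put [I] itself in a hyperplane; for exponent 0 and J = I the excluded
     inclusion is trivially true. *)
  apply: (no_red I 0%N a nza) => // x /eqIg [e ->].
  have regroup (h : nat -> R) : (\sum_(j < k) e j * (\sum_(i < n) M j i * h i) =
      \sum_(i < n) (\sum_(j < k) e j * M j i) * h i)%R.
    under eq_bigr do rewrite mulr_sumr.
    rewrite exchange_big; apply: eq_bigr => i _ /=.
    by rewrite mulr_suml; apply: eq_bigr => j _; rewrite mulrA.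
  exists (fun i => \sum_(j < k) e j * M j i)%R; split.
    by rewrite -regroup; apply: eq_bigr => j _; rewrite gM.
  rewrite -regroup; apply: (big_ind m) => [|y z|j _].
  + exact: ideal0 (ideal_m locR).
  + exact: idealD (ideal_m locR).
  + by apply: idealMl (ideal_m locR) _; apply: ha.
- move=> J [[idJ [sJI [k [_ eqk]]]] neqJI].
  have [fJ|[a [nza ha]]] := proper_in_hyperplane noethR locR n f idJ.
    apply: neqJI; apply: rset_eqW => // x /span_natP [b ->].
    apply: (@ideal_sum _ _ _ (fun i => b i * f i)%R) => // i lt_in.
    by apply: idealMl => //; apply: fJ.
  apply: (no_red J k a nza) => [x Jx|x /eqk //].
  have /span_natP [b eb] := sJI _ Jx; exists b; split=> //.
  by apply: ha; rewrite -eb.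
- move=> le_dn; have idm := ideal_m locR.
  have [t0 _] : exists t : T, forall i, (i < n)%N -> m (1 - c t i)%R.
    by apply: (cov (fun=> 1%R)); exists 0%N => //; apply: m_neq1.
  apply: m_primaryP => //.
    move=> x /span_natP [b ->].
    apply: (@ideal_sum _ _ _ (fun i => b i * f i)%R) => // i lt_in; apply: idealMl => //.
    apply: (ideal_subr idm (prime_sub_m noethR locR (prP t0) (hf _ t0 lt_in))).
    by apply: idealMl => //; case: (hu t0).
  move=> Q prQ sIQ; apply: NNPP => nmQ.
  have fQ i : (i < n)%N -> Q (f i).
    by move=> lt_in; apply/sIQ/(span_gen (fun i : 'I_n => f i) (Ordinal lt_in)).
  (* If [Q] does not contain [m], the chain from [Q] to [m] has length 1 and gives 1 + n <= d. *)
  have := @dimf (fun i => if i is 0 then Q else m) 1%N.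
  rewrite add1n leqNgt ltnS le_dn => absurd; suff: false by []; apply: absurd => //=.
  + split=> [[|i] _|[|i] //= _] //=; first exact: (prime_m noethR locR).
    by split=> [|/(_ _) eqQm]; [apply: prime_sub_m|apply: nmQ => x /eqQm].
  (* If [P t] lay in [Q], coheight one would give Q = P t, and all the products [c t i * u t] would
     lie in [P t], although some [c t i] is a unit. *)
  + split=> // t sPQ; have [_ [_ /(_ Q prQ sPQ) [sQP|//]]] := coP t.
    have [i lt_in] := cm t; apply; apply: (prime_sub_m noethR locR (prP t)).
    have := ideal_subl (prime_idealW (prP t)) (hf i t lt_in) (sQP _ (fQ i lt_in)).
    by move=> /(primeM (prP t)) []//; case: (hu t) => _ [].
Qed.
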